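(* Let $\mu$ be an absolutely continuous probability measure on the square $Q=[0,1]\times[0,1]$, let $n\le m$ be positive integers, and let $c>0$. Then at least one of the following holds. (1) There exist partitions of $[0,1]$ into segments $[0,1]=I_1\cup\ldots\cup I_n$ and $[0,1]=J_1\cup\ldots\cup J_m$ such that $\mu(I_i\times J_j)<c$ for all $i\in[n]$, $j\in[m]$. (2) For every representation $m=a_1+a_2+\ldots+a_n$ of $m$ as a sum of $n$ positive integers there exist partitions of $[0,1]$ into segments $[0,1]=I_1\cup\ldots\cup I_n$ and $[0,1]=J_1\cup\ldots\cup J_m$ and a map $\sigma:[m]\to[n]$ such that $|\sigma^{-1}(i)|=a_i$ for all $i\in[n]$ and $\mu(I_{\sigma(j)}\times J_j)\ge c$ for all $j\in[m]$.
   Context: $[n]=\{1,2,\ldots,n\}$. Absolutely continuous means with respect to Lebesgue measure. A partition of $[0,1]$ into $k$ segments $I_1,\ldots,I_k$ consists of consecutive closed segments, numbered from left to right, $I_i=[s_{i-1},s_i]$ with $0=s_0\le s_1\le\ldots\le s_k=1$ (degenerate segments are allowed); such partitions are parameterized by the lengths of their segments. A pair of partitions $I$, $J$ induces the partition of $Q$ into the rectangles $I_i\times J_j$. *)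

(* Defs.v *)
(* Library: MathComp and MathComp-Analysis. *)
From mathcomp Require Import all_boot all_order all_algebra.
From mathcomp Require Import all_classical all_reals all_analysis.

Set Implicit Arguments.
Unset Strict Implicit.
Unset Printing Implicit Defensive.

Import Order.TTheory GRing.Theory Num.Theory.

Local Open Scope classical_set_scope.
Local Open Scope ring_scope.

(* Only the values cutpt 0, ..., cutpt k are constrained and used; the values of
   cutpt beyond k are junk. The inequalities are weak, so segments may be
   degenerate. *)
Record partition01 (R : realType) (k : nat) := Partition01 {
  cutpt :> nat -> R ;
  cutpt_first : cutpt 0%N = 0 ;
  cutpt_last : cutpt k = 1 ;
  cutpt_le : forall i : 'I_k, cutpt i <= cutpt i.+1
}.

(* Indices start at 0: seg I i is the (i+1)-st segment from the left. *)
Definition seg (R : realType) (k : nat) (I : partition01 R k) (i : 'I_k) :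
  set R := `[I i, I i.+1].

Definition unit_square (R : realType) : set (R * R) :=
  `[0, 1] `*` `[0, 1].

(* The probability measures on the unit square are taken to be the Borel
   probability measures mu on the plane with mu Q = 1. *)
Definition probability_on_square (R : realType)
    (mu : probability (measurableTypeR R * measurableTypeR R)%type R) : Prop :=
  mu (@unit_square R) = 1%E.

Definition absolutely_continuous (R : realType)
    (mu : probability (measurableTypeR R * measurableTypeR R)%type R) : Prop :=
  mu `<< (@lebesgue_measure R \x @lebesgue_measure R)%E.

(* Main.v *)
(* Encode a pair of partitions by the lengths of their segments, a point v of a
   simplex. If (1) fails, then for every c' < c the truncated cell masses
   r i j = max 0 (mu (I_i x J_j) - c') have a positive total and vary continuously
   with v; they vanish on degenerate segments because mu charges no line. A
   Sperner-type covering theorem, deduced from Scarf's combinatorial theorem,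
   yields a v at which the row and column sums of r are proportional to a_1, ...,
   a_n and 1, ..., 1. By Hall's theorem the support of such a matrix contains a map
   sigma as in (2), with c' in place of c; compactness lets c' tend to c. *)
Require Import Defs.
From mathcomp Require Import all_boot zify.

Set Implicit Arguments.
Unset Strict Implicit.
Unset Printing Implicit Defensive.

(** * Scarf's theorem *)

(** The unknown is a point of a product of two simplices, while the covering theorem speaks of one
    simplex. Both vectors of lengths are therefore put into a single simplex, and the cover is
    chosen so that the point found splits its total evenly between them. The covering theorem puts
    no boundary condition on the cover, but it is silent about an index whose coordinate is zero.
    This is where vanishing on degenerate segments enters: a degenerate row or column has sum 0 and
    satisfies the wanted inequality by itself. Only upper bounds on the row and column sums are
    imposed; since the prescribed shares add up to the total, upper bounds in all rows force
    equalities, and likewise in all columns. Truncating at [c] itself would not do: the failure of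
    (1) only gives a cell of mass at least [c], so the excesses over [c] could all be zero, and a
    zero matrix has every proportion but no support. *)

Section Scarf.
Variables (T I : finType) (r : I -> T -> nat) (c : T -> I).
Hypothesis r_inj : forall i, injective (r i).

(* A room (A, C) is a dominant pair with as many points as orders; a door has
   one point less. Every door lies in two rooms, except that a door without
   points lies in one, so rooms and doors behave like the facets and ridges of a
   triangulation although no triangulation is built. *)
Definition dominant (A : {set T}) (C : {set I}) :=
  [forall y, exists i in C, forall x in A, r i y <= r i x].

Definition room (p : {set T} * {set I}) :=
  dominant p.1 p.2 && (#|p.1| == #|p.2|).

Definition door (q : {set T} * {set I}) :=
  dominant q.1 q.2 && (#|q.2| == #|q.1|.+1).

Definition incident (q p : {set T} * {set I}) :=
  (q.1 \subset p.1) && (p.2 \subset q.2).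

Definition minimizer i (A : {set T}) x :=
  (x \in A) && [forall y in A, r i x <= r i y].

Lemma dominantP (A : {set T}) (C : {set I}) :
  reflect (forall y, exists2 i, i \in C & forall x, x \in A -> r i y <= r i x)
          (dominant A C).
Proof.
apply: (iffP forallP) => dom y.
  have /existsP[i /andP[Ci /forall_inP le_y]] := dom y.
  by exists i.
have [i Ci le_y] := dom y.
by apply/existsP; exists i; rewrite Ci; apply/forall_inP.
Qed.

Lemma dominantS (A A' : {set T}) (C C' : {set I}) :
  A' \subset A -> C \subset C' -> dominant A C -> dominant A' C'.
Proof.
move=> /subsetP sA /subsetP sC /dominantP dom; apply/dominantP => y.
by have [i Ci le_y] := dom y; exists i => [|x /sA /le_y]; rewrite ?sC.
Qed.

Lemma minimizer_ex i (A : {set T}) : A != set0 -> exists x, minimizer i A x.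
Proof.
case/set0Pn => x0 Ax0.
case: (arg_minnP (r i) Ax0) => x Ax le_x.
by exists x; apply/andP; split=> //; apply/forall_inP.
Qed.

Lemma minimizer_uniq i A x y : minimizer i A x -> minimizer i A y -> x = y.
Proof.
move=> /andP[Ax /forall_inP le_x] /andP[Ay /forall_inP le_y].
by apply: (@r_inj i); apply/eqP; rewrite eqn_leq le_x // le_y.
Qed.

Lemma dominant_minimizer A C x :
  dominant A C -> x \in A -> exists2 i, i \in C & minimizer i A x.
Proof.
move=> /dominantP /(_ x)[i Ci le_x] Ax; exists i => //.
by rewrite /minimizer Ax; apply/forall_inP.
Qed.

(** By [dominant_minimizer] every point of [A] is the minimizer of some order of [C]. If [i] and [j]
    shared a minimizer, the orders of [C :\ j] would still reach all of [A], which has more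
    elements. *)
Lemma room_minimizer_inj A C i j x : room (A, C) -> i \in C -> j \in C ->
  minimizer i A x -> minimizer j A x -> i = j.
Proof.
move=> /andP[/= dom /eqP card_AC] Ci Cj min_i min_j.
apply/eqP; apply/negP => /negP ne_ij.
have /set0Pn A0 : exists x, x \in A by exists x; case/andP: min_i.
have [f fP] : exists f : {ffun I -> T}, forall k, minimizer k A (f k).
  have ex k : exists x, minimizer k A x by exact: minimizer_ex.
  by exists [ffun k => xchoose (ex k)] => k; rewrite ffunE; exact: xchooseP.
have : A \subset f @: (C :\ j).
  apply/subsetP => y Ay; have [k Ck min_k] := dominant_minimizer dom Ay.
  have fk : f k = y := minimizer_uniq (fP k) min_k.
  have [ekj|ne_kj] := eqVneq k j.
    apply/imsetP; exists i; first by rewrite !inE ne_ij Ci.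
    subst k; rewrite -fk (minimizer_uniq (fP j) min_j).
    exact: minimizer_uniq min_i (fP i).
  by apply/imsetP; exists k => //; rewrite !inE ne_kj Ck.
move=> /subset_leq_card.
have : #|f @: (C :\ j)| <= #|C :\ j| := leq_imset_card f _.
by have := cardsD1 j C; rewrite Cj; lia.
Qed.

(** For [q = (B, D)] and [p = (A, C)] one has |B| <= |A| = |C| <= |D| = |B| + 1, so one of the two
    inclusions is an equality and the other misses a single element. *)
Lemma incident_room_cases q p : room p -> door q -> incident q p ->
  (exists2 e, e \in q.2 & p = (q.1, q.2 :\ e)) \/
  (exists2 x, x \notin q.1 & p = (x |: q.1, q.2)).
Proof.
case: q p => [B D] [A C] /andP[/= _ /eqP cp] /andP[/= _ /eqP cq] /andP[/= sBA sCD].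
have := subset_leq_card sBA; rewrite leq_eqVlt => /orP[/eqP eBA|ltBA].
  have eAB : B = A by apply/eqP; rewrite eqEcard sBA /= eBA.
  left; subst B.
  have : C \proper D by rewrite properEcard sCD /=; lia.
  case/properP => _ [e De nCe]; exists e => //; congr pair.
  apply/eqP; rewrite eqEcard subsetD1 sCD nCe /=.
  by have := cardsD1 e D; rewrite De; lia.
have := subset_leq_card sCD => leCD.
have eCD : C = D by apply/eqP; rewrite eqEcard sCD /=; lia.
right; subst D.
have : B \proper A by rewrite properEcard sBA.
case/properP => _ [x Ax nBx]; exists x => //; congr pair.
apply/eqP; rewrite eq_sym eqEcard subUset sub1set Ax sBA /=.
by have := cardsU1 x B; rewrite nBx; lia.
Qed.

Lemma incident_door_cases q p : room p -> door q -> incident q p ->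
  (exists2 x, x \in p.1 & q = (p.1 :\ x, p.2)) \/
  (exists2 e, e \notin p.2 & q = (p.1, e |: p.2)).
Proof.
move=> rp dq inc; case: (incident_room_cases rp dq inc) => -[e he ->] /=.
  right; exists e; first by rewrite !inE eqxx.
  by rewrite setD1K // -surjective_pairing.
left; exists e; first by rewrite !inE eqxx.
by rewrite setU1K // -surjective_pairing.
Qed.

Lemma room_setD1 (A : {set T}) (C : {set I}) x :
  x \in A -> room (A, C) -> door (A :\ x, C).
Proof.
move=> Ax /andP[/= dom /eqP card_AC].
by rewrite /door (dominantS _ _ dom) ?subD1set //= -card_AC (cardsD1 x A) Ax.
Qed.

Lemma room_setU1 (A : {set T}) (C : {set I}) e :
  e \notin C -> room (A, C) -> door (A, e |: C).
Proof.
move=> Ce /andP[/= dom /eqP card_AC].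
by rewrite /door (dominantS _ _ dom) ?subsetUr //= card_AC cardsU1 Ce.
Qed.

(** Over the single order [i], a one-point set is dominant exactly when its point is the
    [i]-largest. Dropping [i] instead would leave no order to dominate with. *)
Lemma outer_door_rooms (x0 : T) i :
  odd #|[set p | room p & incident (set0, [set i]) p]|.
Proof.
case: (arg_maxnP (r i) (isT : xpredT x0)) => x _ max_x.
suff -> : [set p | room p & incident (set0, [set i]) p] = [set ([set x], [set i])].
  by rewrite cards1.
have dq : door (set0, [set i]).
  rewrite /door /= cards0 cards1 eqxx andbT; apply/dominantP => y.
  by exists i; rewrite ?inE // => z; rewrite inE.
apply/setP => p; rewrite !inE; apply/andP/eqP => [[rp inc]|->].
  case: (incident_room_cases rp dq inc) => /= -[e].
    rewrite inE => /eqP -> ep; move: rp; rewrite ep setDv.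
    by case/andP => /dominantP /(_ x0)[k]; rewrite inE.
  move=> _ ep; rewrite ep setU0; congr ([set _], _).
  move: rp; rewrite ep setU0 => /andP[/dominantP /(_ x)[k]].
  rewrite inE => /eqP -> /(_ e); rewrite inE eqxx => /(_ isT) le_xe _.
  by apply: (@r_inj i); apply/eqP; rewrite eqn_leq le_xe andbT; exact: max_x.
rewrite /room /incident /= !cards1 sub0set subxx; split=> //.
rewrite andbT; apply/dominantP => y; exists i; rewrite ?inE // => z.
by rewrite inE => /eqP ->; exact: max_x.
Qed.

(* Sending each order of D to its minimizer on B identifies exactly two orders
   i and j. For each k among them there is one room: drop k if no point beats all
   the other minima, else add the k-largest such point. *)
Lemma inner_door_rooms B D : door (B, D) -> B != set0 ->
  ~~ odd #|[set p | room p & incident (B, D) p]|.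
Proof.
move=> dq B0; have /andP[/= dom /eqP card_BD] := dq.
have [f fP] : exists f : {ffun I -> T}, forall k, minimizer k B (f k).
  have ex k : exists x, minimizer k B x by exact: minimizer_ex.
  by exists [ffun k => xchoose (ex k)] => k; rewrite ffunE; exact: xchooseP.
have fB k : f k \in B by have /andP[] := fP k.
have f_le k x : x \in B -> r k (f k) <= r k x.
  by have /andP[_ /forall_inP le_f] := fP k; exact: le_f.
have [i Di [j Dj [ne_ij eq_f]]] :
    exists2 i, i \in D & exists2 j, j \in D & i != j /\ f i = f j.
  have : ~~ [forall i in D, forall j in D, (f i == f j) ==> (i == j)].
    apply/negP => /forall_inP inj.
    have : #|f @: D| = #|D|.
      apply: card_in_imset => i j Di Dj eq_f; apply/eqP.
      by move/forall_inP: (inj i Di) => /(_ j Dj) /implyP; apply; apply/eqP.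
    have : f @: D \subset B by apply/subsetP => _ /imsetP[k _ ->].
    by move/subset_leq_card; lia.
  case/forall_inPn => i Di /forall_inPn[j Dj]; rewrite negb_imply.
  by case/andP => /eqP eq_f ne; exists i => //; exists j.
pose above k := [set y | [forall l in D :\ k, r l (f l) < r l y]].
have aboveP k y : reflect (forall l, l \in D -> l != k -> r l (f l) < r l y)
    (y \in above k).
  rewrite inE; apply: (iffP forall_inP) => ab l.
    by move=> Dl nlk; apply: ab; rewrite !inE nlk.
  by rewrite !inE => /andP[? ?]; exact: ab.
have above_dom k y : y \in above k -> k \in D /\ r k y <= r k (f k).
  move=> /aboveP ab; have /dominantP /(_ y)[l Dl le_y] := dom.
  have [<-|nlk] := eqVneq l k; first by split=> //; exact: le_y.
  by have := ab l Dl nlk; rewrite ltnNge le_y.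
(* If [k] were neither [i] nor [j], the point [f i = f j] would be minimal for both orders in the
   room, against [room_minimizer_inj]. *)
have opposite p k : room p ->
    (p = (B, D :\ k) /\ k \in D) \/
    (exists x, [/\ p = (x |: B, D), x \notin B, k \in D &
                   minimizer k (x |: B) x]) -> k = i \/ k = j.
  move=> rp cases; have [->|nki] := eqVneq k i; first by left.
  have [->|nkj] := eqVneq k j; first by right.
  case/eqP: ne_ij; case: cases => [[ep Dk]|[x [ep nBx Dk mink]]].
    move: rp; rewrite ep => rp.
    apply: (room_minimizer_inj rp _ _ (fP i)).
    - by rewrite !inE eq_sym nki.
    - by rewrite !inE eq_sym nkj.
    - by rewrite eq_f; exact: fP.
  move: rp; rewrite ep => rp.
  have min_f l : l \in D -> l != k -> minimizer l (x |: B) (f l).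
    move=> Dl nlk; rewrite /minimizer !inE fB orbT; apply/forall_inP => y.
    rewrite !inE => /orP[/eqP ->|]; last exact: f_le.
    rewrite leqNgt; apply/negP => lt_x; case/eqP: nlk.
    apply: (room_minimizer_inj rp _ _ _ mink) => //.
    rewrite /minimizer !inE eqxx; apply/forall_inP => z.
    rewrite !inE => /orP[/eqP -> //|Bz].
    by rewrite (leq_trans (ltnW lt_x)) // f_le.
  apply: (room_minimizer_inj rp Di Dj (min_f _ Di _)).
    by rewrite eq_sym.
  by rewrite eq_f; apply: min_f; rewrite // eq_sym.
have side k : k = i \/ k = j -> exists p,
    [/\ room p, incident (B, D) p,
     (p = (B, D :\ k) \/ exists2 x, x \in above k & p = (x |: B, D)) &
     forall p', room p' -> (p' = (B, D :\ k) \/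
      exists x, [/\ p' = (x |: B, D), x \notin B & minimizer k (x |: B) x]) ->
      p' = p].
  move=> k_ij.
  have Dk : k \in D by case: k_ij => ->.
  (* The order that collides with [k] has the same minimizer, so [k] can be spared. *)
  have f_onto x : x \in B -> exists2 l, l \in D :\ k & f l = x.
    move=> Bx; have [l Dl min_l] := dominant_minimizer dom Bx.
    have fl := minimizer_uniq (fP l) min_l.
    have [elk|nlk] := eqVneq l k; last by exists l; rewrite // !inE nlk.
    subst l; case: k_ij => ek; subst k.
      by exists j; rewrite -?eq_f // !inE eq_sym ne_ij.
    by exists i; rewrite ?eq_f // !inE ne_ij.
  have above_nB x : x \in above k -> x \notin B.
    move=> /aboveP ab; apply/negP => /f_onto[l]; rewrite !inE => /andP[nlk Dl] fl.
    by have := ab l Dl nlk; rewrite fl ltnn.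
  have min_above x : room (x |: B, D) -> x \notin B -> minimizer k (x |: B) x ->
      x \in above k.
    move=> rx nBx min_x; apply/aboveP => l Dl nlk; rewrite ltnNge; apply/negP => le_x.
    case/eqP: nlk; apply: (room_minimizer_inj rx Dl Dk _ min_x).
    rewrite /minimizer !inE eqxx; apply/forall_inP => z.
    rewrite !inE => /orP[/eqP -> //|Bz].
    by rewrite (leq_trans le_x) // f_le.
  have [above0|] := eqVneq (above k) set0.
    exists (B, D :\ k); split.
    - rewrite /room /=; apply/andP; split; last first.
        by have := cardsD1 k D; rewrite Dk; lia.
      apply/dominantP => y; have : y \notin above k by rewrite above0 inE.
      rewrite inE => /forall_inPn[l Dl]; rewrite -leqNgt => le_y.
      by exists l => // x /(f_le l) /(leq_trans le_y).
    - by rewrite /incident /= subxx subD1set.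
    - by left.
    move=> p' rp' [//|[x [ep nBx min_x]]].
    move: rp'; rewrite ep => /min_above /(_ nBx min_x).
    by rewrite above0 inE.
  case/set0Pn => x1 ax1.
  case: (arg_maxnP (r k) ax1) => x ax max_x.
  exists (x |: B, D); split.
  - rewrite /room /=; apply/andP; split; last by rewrite cardsU1 above_nB // add1n card_BD.
    apply/dominantP => y; have [ay|nay] := boolP (y \in above k).
      exists k => // z; rewrite !inE => /orP[/eqP ->|/(f_le k)].
        exact: max_x.
      by apply: leq_trans; have [] := above_dom _ _ ay.
    move: nay; rewrite inE => /forall_inPn[l]; rewrite !inE -leqNgt.
    move=> /andP[nlk Dl] le_y; exists l => // z; rewrite !inE.
    case/orP => [/eqP ->|/(f_le l)]; last exact: leq_trans.
    by move/aboveP: ax => /(_ l Dl nlk) /ltnW; apply: leq_trans.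
  - by rewrite /incident /= subxx subsetUr.
  - by right; exists x.
  move=> p' rp' [ep|[x' [ep nBx' min_x']]]; move: rp'; rewrite ep.
    case/andP => /= /dominantP /(_ x)[l]; rewrite !inE => /andP[nlk Dl] le_x _.
    by move/aboveP: ax => /(_ l Dl nlk); rewrite ltnNge le_x.
  move=> rp'; have ax' := min_above _ rp' nBx' min_x'.
  suff -> : x' = x by [].
  apply: (@r_inj k); apply/eqP; rewrite eqn_leq [r k x' <= _]max_x //=.
  move: rp' => /andP[/= /dominantP /(_ x)[l Dl le_x] _].
  have [elk|nlk] := eqVneq l k.
    by rewrite elk in le_x; apply: le_x; rewrite !inE eqxx.
  move/aboveP: ax => /(_ l Dl nlk); rewrite ltnNge le_x // !inE.
  by rewrite fB orbT.
have [p1 [rp1 inc1 form1 uniq1]] := side i (or_introl erefl).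
have [p2 [rp2 inc2 form2 uniq2]] := side j (or_intror erefl).
have ne_p : p1 != p2.
  apply/eqP => e12; rewrite -e12 in form2.
  case: form1 => [e1|[x1 a1 e1]]; case: form2 => [e2|[x2 a2 e2]].
  - move: e2; rewrite e1 => -[/setP /(_ i)].
    by rewrite !inE eqxx ne_ij Di.
  - move: e2; rewrite e1 => -[_ /setP /(_ i)].
    by rewrite !inE eqxx Di.
  - move: e2; rewrite e1 => -[_ /setP /(_ j)].
    by rewrite !inE eqxx Dj.
  have nB1 : x1 \notin B.
    have /andP[_ /eqP] := rp1; rewrite e1 /= cardsU1 card_BD.
    by case: (x1 \in B) => //; rewrite add0n => /n_Sn.
  have e : x1 = x2.
    have : x1 \in x2 |: B by move: e2; rewrite e1 => -[<-]; rewrite !inE eqxx.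
    by rewrite !inE (negPf nB1) orbF => /eqP.
  (* A point in both [above i] and [above j] would beat the minima of all orders of [D], against the
     dominance of the door. *)
  subst x2; have [_ le_x1] := above_dom _ _ a1.
  by move/aboveP: a2 => /(_ i Di ne_ij); rewrite ltnNge le_x1.
suff -> : [set p | room p & incident (B, D) p] = [set p1; p2].
  by rewrite cards2 ne_p.
apply/setP => p; rewrite !inE; apply/andP/orP => [[rp inc]|]; last first.
  by case=> /eqP ->.
have [k [cases1 cases2]] : exists k,
    ((p = (B, D :\ k) /\ k \in D) \/
    (exists x, [/\ p = (x |: B, D), x \notin B, k \in D &
                   minimizer k (x |: B) x])) /\
    (p = (B, D :\ k) \/
      exists x, [/\ p = (x |: B, D), x \notin B & minimizer k (x |: B) x]).
  case: (incident_room_cases rp dq inc) => /= -[e he ep].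
    by exists e; split; left.
  have := rp; rewrite {1}ep => /andP[/= domp _].
  have [k Dk min_k] := dominant_minimizer domp (setU11 e B).
  by exists k; split; right; exists e.
case: (opposite p k rp cases1) => ek; subst k.
  by left; rewrite (uniq1 p).
by right; rewrite (uniq2 p).
Qed.

(* The typed doors of a room (A, C) with c @: A != C come in pairs, so counting
   the incidences between rooms and typed doors modulo 2 leaves the door
   (set0, [set i0]) to be matched with a room such that c @: A = C. *)
Definition typed i0 (q : {set T} * {set I}) :=
  [&& door q, i0 \in q.2 & c @: q.1 == q.2 :\ i0].

(** Suppose that dropping [x] gives a typed door. If [c x] is outside [C], its partner is the door
    that adds the order [c x]. Otherwise a second point [y] has the label of [x], and the partner
    drops [y]. *)
Lemma room_typed_doors i0 p : room p -> c @: p.1 != p.2 ->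
  ~~ odd #|[set q | typed i0 q & incident q p]|.
Proof.
case: p => A C rp /= ncol; have /andP[/= _ /eqP card_AC] := rp.
set Q := [set q | _ & _].
have QP q : reflect
    ((exists x, [/\ x \in A, q = (A :\ x, C), i0 \in C & c @: (A :\ x) = C :\ i0]) \/
     (exists e, [/\ e \notin C, e != i0, q = (A, e |: C), i0 \in C &
                   c @: A = e |: C :\ i0])) (q \in Q).
  rewrite inE; apply: (iffP andP) => [[/and3P[dq q0 /eqP cq] inc]|].
    case: (incident_door_cases rp dq inc) => /= -[e he eq].
      by left; exists e; move: q0 cq; rewrite eq.
    right; exists e; move: q0 cq; rewrite eq /= !inE => q0 cA.
    have ne : e != i0.
      by apply: contra_neq ncol => ei; rewrite cA ei setU1K // -ei.
    have C0 : i0 \in C by case/orP: q0 => // /eqP e0; rewrite e0 eqxx in ne.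
    split=> //; rewrite cA; apply/setP => l; rewrite !inE.
    by have [->|] := eqVneq l e; rewrite ?ne //= ?andbT.
  case=> [[x [Ax -> C0 cA]]|[e [nCe ne -> C0 cA]]].
    by rewrite /typed /incident /= room_setD1 //= C0 cA eqxx subD1set subxx.
  rewrite /typed /incident /= room_setU1 //= subxx subsetUr !inE C0 orbT cA.
  split=> //; apply/eqP/setP => l; rewrite !inE.
  by have [->|] := eqVneq l e; rewrite ?ne //= ?andbT.
suff even : forall q, q \in Q -> exists2 q', q != q' & Q = [set q; q'].
  have [->|/set0Pn[q Qq]] := eqVneq Q set0; first by rewrite cards0.
  by have [q' ne ->] := even q Qq; rewrite cards2 ne.
have mixed x e : x \in A -> e \notin C -> i0 \in C -> c x = e ->
    c @: (A :\ x) = C :\ i0 -> Q = [set (A :\ x, C); (A, e |: C)].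
  move=> Ax nCe C0 cx cAx.
  have ne : e != i0 by apply: contraNneq nCe => ->.
  have cA : c @: A = e |: C :\ i0 by rewrite -(setD1K Ax) imsetU1 cx cAx.
  apply/setP => q; apply/QP/set2P.
    case=> [[y [Ay -> _ cAy]]|[f [nCf nf -> _ cA']]]; [left|right].
      have [-> //|nxy] := eqVneq y x.
      have : c x \in C :\ i0 by rewrite -cAy imset_f // !inE eq_sym nxy.
      by rewrite cx !inE (negPf nCe) andbF.
    have : f \in e |: C :\ i0 by rewrite -cA cA' !inE eqxx.
    by rewrite !inE (negPf nCf) andbF orbF => /eqP ->.
  case=> ->; first by left; exists x.
  by right; exists e.
move=> q /QP[[x [Ax -> C0 cAx]]|[e [nCe ne -> C0 cA]]]; last first.
  have : e \in c @: A by rewrite cA !inE eqxx.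
  case/imsetP => x Ax ex; exists (A :\ x, C).
    apply/eqP => -[/setP /(_ x)]; by rewrite !inE eqxx Ax.
  rewrite setUC; apply: mixed => //; apply/eqP; rewrite eqEcard; apply/andP; split.
    have c_inj : {in A &, injective c}.
      apply/imset_injP; rewrite cA cardsU1 !inE (negPf nCe) andbF.
      by have := cardsD1 i0 C; rewrite C0; lia.
    apply/subsetP => _ /imsetP[y /setD1P[nyx Ay] ->].
    have : c y \in e |: C :\ i0 by rewrite -cA imset_f.
    rewrite in_setU1 !inE => /orP[/eqP cye|//].
    by case/eqP: nyx; apply: c_inj => //; rewrite cye.
  have : #|c @: A| <= #|c @: (A :\ x)|.+1.
    by rewrite -{1}(setD1K Ax) imsetU1 cardsU1; case: (_ \notin _) => /=; lia.
  rewrite cA cardsU1 !inE (negPf nCe) andbF /=; lia.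
have [Ccx|nCcx] := boolP (c x \in C); last first.
  exists (A, c x |: C); last exact: mixed.
  by apply/eqP => -[/setP /(_ x)]; rewrite !inE eqxx Ax.
have cx0 : c x != i0.
  apply: contra_neq ncol => cx.
  by rewrite -(setD1K Ax) imsetU1 cx cAx setD1K.
have : c x \in c @: (A :\ x) by rewrite cAx !inE cx0.
case/imsetP => y; rewrite !inE => /andP[nyx Ay] cxy.
have cAy : c @: (A :\ y) = C :\ i0.
  rewrite -cAx; apply/eqP; rewrite eqEsubset; apply/andP; split.
    apply/subsetP => _ /imsetP[z /setD1P[nzy Az] ->].
    have [->|nzx] := eqVneq z x; last by rewrite imset_f // !inE nzx.
    by rewrite cxy imset_f // !inE nyx.
  apply/subsetP => _ /imsetP[z /setD1P[nzx Az] ->].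
  have [->|nzy] := eqVneq z y; last by rewrite imset_f // !inE nzy.
  by rewrite -cxy imset_f // !inE eq_sym nyx.
exists (A :\ y, C).
  by apply/eqP => -[/setP /(_ x)]; rewrite !inE eqxx Ax eq_sym nyx.
apply/setP => d; apply/QP/set2P.
  case=> [[z [Az -> _ cAz]]|[f [nCf nf -> _ cA']]].
    have c_inj : {in A :\ z &, injective c}.
      apply/imset_injP; rewrite cAz.
      have := cardsD1 i0 C; rewrite C0 -card_AC (cardsD1 z A) Az => /eqP.
      by rewrite eqn_add2l eq_sym.
    have [->|nzx] := eqVneq z x; first by left.
    have [->|nzy] := eqVneq z y; first by right.
    by case/eqP: nyx; apply: c_inj; rewrite // !inE 1?eq_sym ?nzx ?nzy.
  have : f \in c @: A by rewrite cA' !inE eqxx.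
  rewrite -(setD1K Ax) imsetU1 cAx !inE (negPf nCf) andbF orbF => /eqP ef.
  by rewrite ef Ccx in nCf.
by case=> ->; left; [exists x|exists y].
Qed.

Theorem scarf (x0 : T) (i0 : I) : exists p, room p /\ c @: p.1 = p.2.
Proof.
have [/existsP[p /andP[rp /eqP cp]]|/existsPn none] :=
    boolP [exists p, room p && (c @: p.1 == p.2)]; first by exists p.
pose e q p := [&& typed i0 q, room p & incident q p].
have : \sum_p \sum_q e q p = \sum_q \sum_p e q p by rewrite exchange_big.
have sum_card (U : finType) (P : pred U) : \sum_x (P x : nat) = #|[set x | P x]|.
  by rewrite -sum1dep_card [RHS]big_mkcond; apply: eq_bigr => x _; case: (P x).
move/(congr1 odd); rewrite !(big_morph odd oddD (erefl : odd 0 = false)).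
rewrite big1 => [|p _]; last first.
  rewrite sum_card; apply/negbTE; have [rp|nrp] := boolP (room p).
    have := none p; rewrite rp /= => /(room_typed_doors i0 rp).
    by congr (~~ odd _); apply: eq_card => q; rewrite !inE /e rp.
  rewrite (_ : [set _ | _] = set0) ?cards0 //.
  by apply/setP => q; rewrite !inE /e (negPf nrp) andbF.
have outer : typed i0 (set0, [set i0]).
  rewrite /typed /door /= !cards0 cards1 eqxx andbT inE eqxx imset0 setDv eqxx.
  by rewrite !andbT; apply/dominantP => y; exists i0; rewrite ?inE // => z; rewrite inE.
rewrite (bigD1 (set0, [set i0])) //= [X in _ (+) X]big1 => [|q nq].
  rewrite addbF sum_card.
  rewrite (_ : [set _ | _] = [set p | room p & incident (set0, [set i0]) p]).
    by rewrite outer_door_rooms.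
  by apply/setP => p; rewrite !inE /e outer.
rewrite sum_card; apply/negbTE; have [tq|ntq] := boolP (typed i0 q); last first.
  rewrite (_ : [set _ | _] = set0) ?cards0 //.
  by apply/setP => p; rewrite !inE /e (negPf ntq).
rewrite (_ : [set _ | _] = [set p | room p & incident q p]); last first.
  by apply/setP => p; rewrite !inE /e tq.
(* A typed door without points has [i0] as its only order, so it is the outer door, excluded by
   [nq]. *)
case: q tq nq => B D /and3P[/= dq D0 /eqP cB] nq.
apply: inner_door_rooms => //; apply: contra_neq nq => B0; congr pair => //.
by rewrite -(setD1K D0) -cB B0 imset0 setU0.
Qed.

End Scarf.

(** * Labellings of the grid points of a simplex *)

Definition grid d N := {k : {ffun 'I_d -> 'I_N.+1} | \sum_(i < d) k i == N}.

Lemma grid_above d N (C : {set 'I_d}) (g : 'I_d -> nat) : C != set0 ->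
  \sum_(i in C) g i <= N ->
  exists y : grid d N, forall i, i \in C -> g i <= val y i.
Proof.
case/set0Pn => i0 C0 leN.
(* The coordinate [i0] absorbs what is left of [N]. *)
pose h i := if i == i0 then g i0 + (N - \sum_(i in C) g i)
            else if i \in C then g i else 0.
have sum_h : \sum_i h i = N.
  rewrite (bigD1 i0) //= {1}/h eqxx.
  rewrite (_ : \sum_(i | i != i0) h i = \sum_(i in C | i != i0) g i).
    by rewrite addnAC -(bigD1 i0) //= subnKC.
  rewrite [RHS]big_mkcondl; apply: eq_bigr => i /negPf ni.
  by rewrite /h ni.
have h_le i : h i < N.+1 by rewrite ltnS -[X in _ <= X]sum_h (bigD1 i) //= leq_addr.
have sum_k : \sum_i [ffun i => Ordinal (h_le i)] i == N.
  by rewrite -[X in _ == X]sum_h; apply/eqP; apply: eq_bigr => i _; rewrite ffunE.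
exists (Sub [ffun i => Ordinal (h_le i)] sum_k : grid d N) => i Ci /=; rewrite ffunE /= /h.
by case: eqP => [->|_]; rewrite ?Ci ?leq_addr.
Qed.

(* Scarf's theorem for the orders of the barycentric coordinates, with ties
   broken by an enumeration. *)
Lemma grid_sperner d N (c : grid d.+1 N -> 'I_d.+1) :
  exists (A : {set grid d.+1 N}) x0, x0 \in A /\
    (forall x y i, x \in A -> y \in A -> val x i <= val y i + d.+1) /\
    (forall i, (exists2 x, x \in A & c x = i) \/
               (forall x, x \in A -> val x i <= d.+1)).
Proof.
pose T : finType := grid d.+1 N.
have [y0 _] : exists y : T, forall i, i \in [set ord0] -> 0 <= val y i.
  by apply: (@grid_above _ _ _ (fun=> 0)); rewrite ?big1 // -card_gt0 cards1.
pose r (i : 'I_d.+1) (x : T) := val x i * #|T| + enum_rank x.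
have rankP (x : T) : enum_rank x < #|T| by exact: ltn_ord.
have r_inj i : injective (r i).
  move=> x y e; apply: enum_rank_inj; apply: ord_inj.
  by have := congr1 (modn^~ #|T|) e; rewrite /r !modnMDl !modn_small.
have r_lt i (x y : T) : val x i < val y i -> r i x < r i y.
  move=> lt; rewrite /r; have := leq_mul lt (leqnn #|T|).
  by have := rankP x; rewrite mulSn; lia.
have [[A C] [/andP[/= dom /eqP card_AC] cA]] := scarf c r_inj y0 ord0.
have C0 : C != set0.
  by have /dominantP /(_ y0)[i Ci _] := dom; apply/set0Pn; exists i.
have A0 : A != set0 by rewrite -card_gt0 card_AC card_gt0.
have [x0 Ax0] := set0Pn _ A0.
pose m i := val [arg min_(x < x0 in A) (val x i : nat)] i : nat.
have m_le i (x : T) : x \in A -> m i <= val x i.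
  by rewrite /m; case: arg_minnP => // z _ le_z /le_z.
(* Otherwise some grid point would exceed every minimum [m i] with [i] in [C], against dominance. *)
have sum_m : N < \sum_(i in C) (m i).+1.
  rewrite ltnNge; apply/negP => leN.
  have [y y_gt] := grid_above C0 leN.
  have /dominantP /(_ y)[i Ci le_y] := dom.
  have := y_gt i Ci; rewrite /m; case: arg_minnP => // z Az _ /r_lt.
  by rewrite ltnNge le_y.
have card_C : #|C| <= d.+1 by rewrite -[X in _ <= X]card_ord max_card.
have {}sum_m : N < \sum_(i in C) m i + d.+1.
  apply: (leq_trans sum_m); rewrite (eq_bigr (fun i => m i + 1)).
    by rewrite big_split /= sum1_card leq_add2l.
  by move=> i _; rewrite addn1.
have sum_x (x : T) : \sum_i val x i = N by apply/eqP; exact: (valP x).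
(* The coordinates of [x] add up to [N], and the minima over [C] already use up all but less than
   [d.+1] of it. Little remains for a coordinate to exceed its minimum, or for a coordinate outside
   [C]. *)
have near_m (x : T) i : x \in A -> i \in C -> val x i <= m i + d.+1.
  move=> Ax Ci; have := sum_m.
  rewrite (bigD1 i) //= -[X in X < _ -> _](sum_x x) (bigD1 i) //=.
  have : \sum_(j in C | j != i) m j <= \sum_(j | j != i) val x j.
    rewrite big_mkcondl; apply: leq_sum => j _.
    by case: ifP => // _; exact: m_le.
  move: (\sum_(j in C | j != i) m j) (\sum_(j | j != i) _); lia.
have off_C (x : T) i : x \in A -> i \notin C -> val x i <= d.+1.
  move=> Ax nCi; have := sum_m; rewrite -[X in X < _ -> _](sum_x x) (bigD1 i) //=.
  have : \sum_(j in C) m j <= \sum_(j | j != i) val x j.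
    rewrite big_mkcond [leqRHS]big_mkcond; apply: leq_sum => j _.
    case: ifP => // Cj; case: eqP => [eji|_]; last exact: m_le.
    by rewrite -eji Cj in nCi.
  move: (\sum_(j in C) m j) (\sum_(j | j != i) _); lia.
exists A, x0; split=> //; split=> [x y i Ax Ay|i].
  have [Ci|nCi] := boolP (i \in C); last by rewrite (leq_trans (off_C _ _ _ _)) ?leq_addl.
  by rewrite (leq_trans (near_m _ _ Ax Ci)) // leq_add2r m_le.
have [Ci|nCi] := boolP (i \in C); last by right => x Ax; exact: off_C.
by left; move: Ci; rewrite -cA => /imsetP[x Ax ->]; exists x.
Qed.

(** * Hall's theorem *)

(* Rado's argument: a set of the family with two elements x, y can be shrunk;
   otherwise witnesses against removing x and y contradict the submodularity
   of the size of a union. *)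
Lemma hall_marriage (J T : finType) (A : J -> {set T}) :
  (forall S : {set J}, #|S| <= #|\bigcup_(j in S) A j|) ->
  exists2 f : J -> T, injective f & forall j, f j \in A j.
Proof.
have [s] := ubnP (\sum_j #|A j|); elim: s A => // s IHs A /ltnSE leAs hallA.
have A_gt0 j : 0 < #|A j| by have := hallA [set j]; rewrite cards1 big_set1.
have [|/forallPn[i]] := boolP [forall j, #|A j| <= 1].
  move/forallP => A_le1.
  have fP j : exists x, A j == [set x].
    have /cards1P[x ->] : #|A j| == 1 by rewrite eqn_leq A_le1 A_gt0.
    by exists x.
  exists (fun j => xchoose (fP j)) => [j j' eq_f|j]; last first.
    by have /eqP {2}-> := xchooseP (fP j); rewrite inE.
  have eA : A j = A j'.
    by have /eqP -> := xchooseP (fP j); have /eqP -> := xchooseP (fP j'); rewrite eq_f.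
  apply/eqP; apply/negPn/negP => ne; have := hallA [set j; j'].
  by rewrite cards2 ne bigcup_setU !big_set1 -eA setUid leqNgt ltnS A_le1.
rewrite -ltnNge => /card_gt1P[x [y [Aix Aiy ne_xy]]].
pose B z j := if j == i then A i :\ z else A j.
have subB z j : B z j \subset A j by rewrite /B; case: eqP => [->|_]; rewrite ?subD1set.
have step z : z \in A i ->
    (exists2 f : J -> T, injective f & forall j, f j \in A j) \/
    exists2 S : {set J}, i \in S & #|\bigcup_(j in S) B z j| < #|S|.
  move=> Aiz; have [/forallP hallB|/forallPn[S]] :=
    boolP [forall S : {set J}, #|S| <= #|\bigcup_(j in S) B z j|].
    left; have [|f f_inj fB] := IHs (B z) _ hallB; last first.
      by exists f => // j; apply: (subsetP (subB z j)).
    rewrite (leq_trans _ leAs) // (bigD1 i) //= [X in _ < X](bigD1 i) //=.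
    rewrite -addSn leq_add //; last by apply: leq_sum => j _; exact: subset_leq_card.
    by rewrite /B eqxx (cardsD1 z (A i)) Aiz.
  rewrite -ltnNge => ltS; right; exists S => //; apply/negPn/negP => nSi.
  move: ltS; rewrite ltnNge (eq_bigr A) ?hallA // => j Sj.
  by rewrite /B; case: eqP => // eji; rewrite -eji Sj in nSi.
have [//|[S Si ltS]] := step x Aix; have [//|[S' S'i ltS']] := step y Aiy.
set U := \bigcup_(j in S) _ in ltS; set V := \bigcup_(j in S') _ in ltS'.
(* One union removes [x] from [A i], the other [y]; as these differ, together they lose nothing. *)
have leU : #|S :|: S'| <= #|U :|: V|.
  rewrite (leq_trans (hallA _)) // subset_leq_card //; apply/bigcupsP => j SSj.
  apply/subsetP => w Ajw; have [eji|ne] := eqVneq j i.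
    have [ewx|nwx] := eqVneq w x; apply/setUP; [right|left]; apply/bigcupP; exists i => //;
      by rewrite /B eqxx !inE -?eji ?Ajw ?ewx ?ne_xy ?nwx.
  have Bw z : w \in B z j by rewrite /B (negPf ne).
  by case/setUP: SSj => Sj; apply/setUP; [left|right]; apply/bigcupP; exists j.
have leI : #|(S :&: S') :\ i| <= #|U :&: V|.
  rewrite (leq_trans (hallA _)) // subset_leq_card //; apply/bigcupsP => j.
  rewrite !inE => /and3P[ne Sj S'j]; apply/subsetP => w Ajw.
  have Bw z : w \in B z j by rewrite /B (negPf ne).
  by apply/setIP; split; apply/bigcupP; exists j.
(* By the two bounds |U| + |V| is at least |S| + |S'| - 1, while each of [U] and [V] is smaller than
   its index set. *)
have := cardsUI U V; have := cardsUI S S'.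
have := cardsD1 i (S :&: S'); rewrite inE Si S'i /=; lia.
Qed.

From mathcomp Require Import all_order all_algebra.

Import Order.TTheory GRing.Theory Num.Theory.

Local Open Scope ring_scope.

(** Replace row [i] by [a i] copies of itself divided by [a i]: in the resulting square matrix all
    rows and columns sum to [t]. As in Birkhoff's theorem, the columns of [S] carry mass [#|S| * t],
    which needs at least [#|S|] rows, so Hall's condition holds. The matching is bijective, hence
    uses all [a i] copies of each row. *)
Lemma transport_support (R : realFieldType) n m (a : 'I_n -> nat)
    (r : 'I_n -> 'I_m -> R) (t : R) : 0 < t ->
  (forall i, (0 < a i)%N) -> (\sum_i a i)%N = m -> (forall i j, 0 <= r i j) ->
  (forall i, \sum_j r i j = (a i)%:R * t) -> (forall j, \sum_i r i j = t) ->
  exists sigma : 'I_m -> 'I_n, (forall i, #|[set j | sigma j == i]| = a i) /\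
    forall j, 0 < r (sigma j) j.
Proof.
move=> t0 a0 sum_a r0 sum_row sum_col.
pose T : finType := {i : 'I_n & 'I_(a i)}.
pose A j := [set k : T | 0 < r (tag k) j].
have cardT : #|T| = m.
  rewrite card_tagged sumnE big_map -sum_a big_enum.
  by apply: eq_bigr => i _; rewrite card_ord.
have col_T j : \sum_(k : T) r (tag k) j / (a (tag k))%:R = t.
  rewrite -(sum_col j) (eq_bigr (fun i => \sum_(l < a i) r i j / (a i)%:R)).
    by rewrite sig_big_dep.
  by move=> i _; rewrite sumr_const card_ord -[RHS]mulr_natr divfK // pnatr_eq0 -lt0n a0.
have [|f f_inj fA] := @hall_marriage _ _ A.
  move=> S; rewrite -(ler_nat R) -(ler_pM2r t0).
  rewrite -!sumr_const !mulr_suml.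
  rewrite (eq_bigr (fun j => \sum_(k : T) r (tag k) j / (a (tag k))%:R)).
    rewrite exchange_big /= [leRHS]big_mkcond /=; apply: ler_sum => k _.
    case: ifPn => [_|nk]; last first.
      rewrite big1 // => j Sj; suff -> : r (tag k) j = 0 by rewrite mul0r.
      apply/eqP; rewrite eq_le r0 andbT leNgt; apply: contra nk => rkj.
      by apply/bigcupP; exists j; rewrite ?inE.
    rewrite mul1r -mulr_suml ler_pdivrMr ?ltr0n // mulrC -sum_row.
    by rewrite [leRHS](bigID (mem S)) /= lerDl sumr_ge0.
  by move=> j _; rewrite col_T mul1r.
have f_bij : bijective f by apply: inj_card_bij; rewrite // cardT card_ord.
exists (fun j => tag (f j)); split=> [i|j]; last by have := fA j; rewrite inE.
rewrite (_ : [set j | _] = f @^-1: [set k : T | tag k == i]); last first.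
  by apply/setP => j; rewrite !inE.
rewrite on_card_preimset; last by exact: onW_bij.
rewrite (_ : [set k | _] = [set Tagged (fun i => 'I_(a i)) l | l : 'I_(a i)]).
  rewrite card_imset ?card_ord // => l l' /eqP.
  by rewrite -tag_eqE /tag_eq eqxx /= tagged_asE => /eqP.
apply/setP => -[i' l]; rewrite inE; apply/eqP/imsetP => /=; last first.
  by case=> l' _ /(congr1 tag).
move=> ei.
by subst i'; exists l.
Qed.

From mathcomp Require Import all_classical all_reals all_analysis lra.

Import numFieldNormedType.Exports.

Local Open Scope classical_set_scope.

(** * Closed covers of a simplex *)

(** Compactness combined with the pigeonhole principle: if near [p] each label disappeared from some
    index on, intersecting the finitely many neighbourhoods and taking the largest index would
    contradict that [p] is a cluster point. *)
Lemma compact_cluster_seq (V : topologicalType) (K : set V) (T : finType)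
    (z : nat -> V) (t : nat -> T) :
  compact K -> (forall k, K (z k)) ->
  exists p t0, K p /\ forall A : set V, nbhs p A -> forall N,
    exists k, [/\ (N <= k)%N, A (z k) & t k = t0].
Proof.
move=> cptK Kz.
have zK : (z @ \oo) K by exists 0%N => // k _; exact: Kz.
have [p [Kp clp]] := cptK (z @ \oo) _ zK.
have [[t0 t0P]|none] := pselect (exists t0, forall A : set V, nbhs p A -> forall N,
    exists k, [/\ (N <= k)%N, A (z k) & t k = t0]); first by exists p, t0.
have missed t0 : exists A N, nbhs p A /\
    forall k, (N <= k)%N -> A (z k) -> t k <> t0.
  apply: contrapT => nex; apply: none; exists t0 => A pA N.
  apply: contrapT => nk; apply: nex; exists A, N; split=> // k Nk Ak tk.
  by apply: nk; exists k.
have [A /choice[N AN]] := choice missed.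
have pA : nbhs p [set v | forall t0, A t0 v].
  by apply: filter_forall => t0; have [] := AN t0.
have zN : (z @ \oo) [set v | exists2 k, (\max_t0 N t0 <= k)%N & v = z k].
  by exists (\max_t0 N t0)%N => // k /= le_k; exists k.
have [_ [[k le_k ->] /(_ (t k))]] := clp _ _ zN pA.
have [_ missed_k] := AN (t k).
by move=> /missed_k /(_ erefl); case; rewrite (leq_trans _ le_k) // leq_bigmax.
Qed.

Lemma continuous_sum (V : topologicalType) (R : realType) (J : Type) (s : seq J)
    (P : pred J) (F : J -> V -> R) :
  (forall j, continuous (F j)) -> continuous (fun v => \sum_(j <- s | P j) F j v).
Proof.
move=> cF; apply: continuous_big => [|j _]; last exact: cF.
exact: add_continuous.
Qed.

Lemma continuous_mull (V : topologicalType) (R : realType) (x : R) (f : V -> R) :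
  continuous f -> continuous (fun v => x * f v).
Proof. by move=> cf v; apply: cvgMl_tmp; exact: cf. Qed.

Lemma continuous_excess (V : topologicalType) (R : realType) (x : R) (f : V -> R) :
  continuous f -> continuous (fun v => Num.max 0 (f v - x)).
Proof.
move=> cf v; apply: (@continuous_max _ _ (cst 0) (fun v => f v - x)).
  exact: cst_continuous.
by apply: cvgB; [exact: cf|exact: cvg_cst].
Qed.

Lemma closed_le_continuous (V : topologicalType) (R : realType) (f g : V -> R) :
  continuous f -> continuous g -> closed [set v | f v <= g v].
Proof.
move=> cf cg; rewrite (_ : mkset _ = (g \- f) @^-1` [set x | 0 <= x]).
  apply: preimage_closed; last exact: closed_ge.
  by move=> v _; apply: continuousB; [exact: cg|exact: cf].
by apply/seteqP; split=> v /=; rewrite subr_ge0.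
Qed.

Definition simplex (R : realType) d : set 'rV[R]_d :=
  [set v | (forall i, 0 <= v ord0 i) /\ \sum_i v ord0 i = 1].
Arguments simplex : clear implicits.

Lemma simplex_compact (R : realType) d : compact (simplex R d).
Proof.
apply: (@subclosed_compact _ _
  [set v : 'rV[R]_d | forall i, `[0, 1]%classic (v ord0 i)]).
- rewrite (_ : simplex R d =
    (\bigcap_(i in [set: 'I_d]) [set v : 'rV[R]_d | 0 <= v ord0 i]) `&`
    ((fun v : 'rV[R]_d => \sum_i v ord0 i) @^-1` [set x | x = 1])).
    apply: closedI.
      apply: closed_bigI => i _; apply: closed_le_continuous.
        by move=> v; exact: cst_continuous.
      exact: coord_continuous.
    apply: preimage_closed; last exact: closed_eq.
    by move=> v _; apply: continuous_sum => i; exact: coord_continuous.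
  by apply/seteqP; split=> v [ge0 sum1]; split=> // i; [move=> _|]; exact: ge0.
- have cpt01 : forall i : 'I_d, compact `[0 : R, 1]%classic.
    by move=> _; exact: segment_compact.
  exact: rV_compact cpt01.
move=> v [ge0 sum1] i; rewrite /= in_itv /= ge0 -sum1 (bigD1 i) //= lerDl.
by apply: sumr_ge0.
Qed.

(** Label each grid point by a set containing it. By [grid_sperner] there are points [zk] such that
    each label [i] occurs near [zk] or coordinate [i] of [zk] is small, both within a bound that
    tends to 0. At a cluster point with positive coordinate [i] only the first can persist, and
    [L i] is closed. *)
Lemma simplex_cover (R : realType) d (L : 'I_d -> set 'rV[R]_d) : (0 < d)%N ->
  (forall i, closed (L i)) -> simplex R d `<=` \bigcup_i L i ->
  exists2 p, simplex R d p & forall i, 0 < p ord0 i -> L i p.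
Proof.
case: d L => // d L _ clL covL.
pose pt k (x : grid d.+1 k.+1) : 'rV[R]_d.+1 :=
  \row_i ((val x i : nat)%:R / k.+1%:R).
have pt_simplex k (x : grid d.+1 k.+1) : simplex R d.+1 (pt k x).
  split=> [i|]; first by rewrite mxE divr_ge0.
  under eq_bigr do rewrite mxE.
  by rewrite -mulr_suml -natr_sum (eqP (valP x)) divff.
have near_cover k : exists zk, simplex R d.+1 zk /\
    forall i, (exists x, [/\ simplex R d.+1 x, L i x &
                 forall j, `|zk ord0 j - x ord0 j| <= d.+1%:R / k.+1%:R]) \/
              zk ord0 i <= d.+1%:R / k.+1%:R.
  have label (x : grid d.+1 k.+1) : exists i, L i (pt k x).
    by have [i _ Li] := covL _ (pt_simplex k x); exists i.
  have [c cP] := choice label.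
  have [A [x0 [Ax0 [near_A lab]]]] := grid_sperner c.
  exists (pt k x0); split=> // i; case: (lab i) => [[x Ax cx]|small].
    left; exists (pt k x); split=> //; first by rewrite -cx.
    move=> j; rewrite !mxE -mulrBl normrM [`|k.+1%:R^-1|]ger0_norm //.
    rewrite ler_pM2r ?invr_gt0 ?ltr0n // ler_distl lerBlDr -!natrD !ler_nat.
    by rewrite !near_A.
  by right; rewrite mxE ler_pM2r ?invr_gt0 ?ltr0n // ler_nat small.
have [z zP] := choice near_cover.
have [p [t0 [sp clp]]] := compact_cluster_seq (fun=> tt) (@simplex_compact R d.+1)
  (fun k => (zP k).1).
exists p => // i p_gt0; apply: contrapT => nLi.
have /nbhs_ballP[e /= e_gt0 Be] : nbhs p (~` L i).
  by apply: open_nbhs_nbhs; split=> //; exact: closed_openC.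
(* The half of [e] pays for the two distances from [p] to [zk] and from [zk] to a point of [L i].
   The half of [p ord0 i] rules out that coordinate [i] of [zk] is small. *)
pose e' := Num.min (e / 2) (p ord0 i / 2).
have e'_gt0 : 0 < e' by rewrite lt_min !divr_gt0.
have [N] : exists N, d.+1%:R / e' < N%:R.
  by exists (Num.bound (d.+1%:R / e')); apply: archi_boundP; rewrite divr_ge0 // ltW.
rewrite ltr_pdivrMr // => lt_N.
have [k [le_Nk zk _]] := clp _ (nbhsx_ballx p _ e'_gt0) N.
have small_k : d.+1%:R / k.+1%:R < e'.
  rewrite ltr_pdivrMr ?ltr0n // mulrC (lt_le_trans lt_N) // ler_pM2r // ler_nat.
  exact: leqW.
have [_ zk'] := zk.
case: ((zP k).2 i) => [[x [_ Lx near_x]]|small_z]; last first.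
  have := zk' ord0 i; rewrite /ball /= ltr_norml => /andP[_].
  move: small_k small_z; rewrite /e' !lt_min => /andP[_ lt1] le2 /andP[_ lt3].
  by have := ltrD lt3 (le_lt_trans le2 lt1); rewrite subrK -splitr ltxx.
apply: (Be x) => //; split=> // i1 j; rewrite (ord1 i1) /ball /=.
have := zk' ord0 j; rewrite /ball /= => pz.
have := near_x j; move: small_k pz; rewrite /e' !lt_min => /andP[lt1 _] /andP[lt2 _] zx.
rewrite (_ : _ - _ = (p ord0 j - z k ord0 j) + (z k ord0 j - x ord0 j)); last by lra.
by rewrite (le_lt_trans (ler_normD _ _)) // [ltRHS]splitr ltrD // (le_lt_trans zx).
Qed.

(** * Continuity of rectangle masses *)

(** The closed strips of half-width [k.+1%:R^-1] decrease to the null fibre over [s], so continuity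
    from above applies. *)
Lemma measure_preimage_small (R : realType) (d : measure_display)
    (T : measurableType d) (mu : {finite_measure set T -> \bar R})
    (f : T -> measurableTypeR R) (s e : R) :
  measurable_fun setT f -> mu (f @^-1` [set s]) = 0%E -> 0 < e ->
  exists2 delta, 0 < delta &
    (mu (f @^-1` `[(s - delta)%R, (s + delta)%R]) < e%:E)%E.
Proof.
move=> mf mus e_gt0.
pose F k := f @^-1` `[s - k.+1%:R^-1, s + k.+1%:R^-1]%classic.
have mpre (A : set (measurableTypeR R)) : measurable A -> measurable (f @^-1` A).
  by move=> mA; rewrite -[X in measurable X]setTI; exact: mf.
have capF : \bigcap_k F k = f @^-1` [set s].
  apply/seteqP; split=> [x Fx|x fx k _] /=; last first.
    by rewrite /F /= fx in_itv /= lerBlDr lerDl invr_ge0 ler0n.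
  apply/eqP; rewrite -subr_eq0 -normr_eq0; apply/negPn/negP => xs.
  have [k] : exists k, `|f x - s|^-1 < k%:R.
    by exists (Num.bound `|f x - s|^-1); apply: archi_boundP; rewrite invr_ge0.
  have dist_gt0 : 0 < `|f x - s| by rewrite lt_def xs normr_ge0.
  move=> lt_k; have := Fx k I; rewrite /F /= in_itv /= -ler_distl leNgt => /negP; apply.
  rewrite -[ltRHS]invrK ltf_pV2 ?posrE ?invr_gt0 ?ltr0n //.
  by rewrite (lt_trans lt_k) // ltr_nat.
have mF k : measurable (F k) by apply: mpre; exact: measurable_itv.
have niF : nonincreasing_seq F.
  apply/nonincreasing_seqP => k; apply/subsetPset => x; rewrite /F /= !in_itv /=.
  rewrite -!ler_distl => /le_trans; apply.
  by rewrite lef_pV2 ?posrE ?ltr0n // ler_nat.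
have cvF : mu \o F @ \oo --> mu (\bigcap_k F k).
  apply: nonincreasing_cvg_mu => //.
    by rewrite -ge0_fin_numE ?measure_ge0 //; apply: fin_num_measure; exact: mF.
  by rewrite capF; apply: mpre; exact: measurable_set1.
rewrite capF mus in cvF; move: cvF.
move=> /(_ [set y | (y < e%:E)%E]) [].
  by apply: open_nbhs_nbhs; split; [exact: open_ereal_lt_ereal|rewrite /= lte_fin].
by move=> k _ /(_ k (leqnn k)) /= lt_e; exists k.+1%:R^-1; rewrite ?invr_gt0 ?ltr0n.
Qed.

Section RectangleMeasure.
Variables (R : realType)
  (mu : probability (measurableTypeR R * measurableTypeR R)%type R).
Hypothesis mu_ac : absolutely_continuous mu.
Local Notation plane := (measurableTypeR R * measurableTypeR R)%type.

Definition rect (a b c d : R) : set plane := `[a, b] `*` `[c, d].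
Definition rect_mass (a b c d : R) : R := fine (mu (rect a b c d)).

Lemma measurable_rect a b c d : measurable (rect a b c d).
Proof. by apply: measurableX; exact: measurable_itv. Qed.

Lemma rect_massE a b c d : (rect_mass a b c d)%:E = mu (rect a b c d).
Proof. by rewrite fineK // fin_num_measure //; exact: measurable_rect. Qed.

Lemma vertical_line_null s :
  mu ((fst : plane -> measurableTypeR R) @^-1` [set s]) = 0%E.
Proof.
have /null_content_dominatesP dom := mu_ac; apply: dom.
  rewrite -[X in measurable X]setTI; apply: measurable_fst => //.
rewrite (_ : _ @^-1` _ = [set s] `*` setT).
  apply: (etrans (@product_measure1E _ _ _ _ _ (@lebesgue_measure R)
    (@lebesgue_measure R) [set s] setT _ _)) => //.
  (* The other factor is the infinite length of the line; the product with 0 is 0. *)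
  rewrite [X in (X * _)%E](_ : _ = 0%E) ?mul0e //; exact: lebesgue_measure_set1.
by apply/seteqP; split=> x //= -[].
Qed.

Lemma horizontal_line_null s :
  mu ((snd : plane -> measurableTypeR R) @^-1` [set s]) = 0%E.
Proof.
have /null_content_dominatesP dom := mu_ac; apply: dom.
  rewrite -[X in measurable X]setTI; apply: measurable_snd => //.
rewrite (_ : _ @^-1` _ = setT `*` [set s]).
  apply: (etrans (@product_measure1E _ _ _ _ _ (@lebesgue_measure R)
    (@lebesgue_measure R) setT [set s] _ _)) => //.
  rewrite [X in (_ * X)%E](_ : _ = 0%E) ?mule0 //; exact: lebesgue_measure_set1.
by apply/seteqP; split=> x //= -[].
Qed.

Lemma rect_mass_degenerate a b c d : a = b \/ c = d -> rect_mass a b c d = 0.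
Proof.
have null (A : set plane) : measurable A -> mu A = 0%E -> rect a b c d `<=` A ->
    rect_mass a b c d = 0.
  move=> mA muA sub.
  have : (mu (rect a b c d) <= mu A)%E.
    by apply: le_measure; rewrite ?inE //; exact: measurable_rect.
  rewrite muA /rect_mass => le0; rewrite (_ : mu _ = 0%E) //.
  by apply/eqP; rewrite eq_le le0 measure_ge0.
case=> eq_cut.
- apply: (null ((fst : plane -> measurableTypeR R) @^-1` [set a])).
  + by rewrite -[X in measurable X]setTI; apply: measurable_fst.
  + exact: vertical_line_null.
  + by move=> x [/=]; rewrite -eq_cut in_itv /= => /le_anti.
- apply: (null ((snd : plane -> measurableTypeR R) @^-1` [set c])).
  + by rewrite -[X in measurable X]setTI; apply: measurable_snd.
  + exact: horizontal_line_null.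
  + by move=> x [/= _]; rewrite -eq_cut in_itv /= => /le_anti.
Qed.

(** When the sides move little, a point of one rectangle outside the other lies in one of four thin
    strips around the sides. Each strip has mass at most [e / 4], and the estimate [mass_le] is
    symmetric in the two rectangles. *)
Lemma rect_mass_continuous (V : topologicalType) (a b c d : V -> R) :
  continuous a -> continuous b -> continuous c -> continuous d ->
  continuous (fun v => rect_mass (a v) (b v) (c v) (d v)).
Proof.
move=> ca cb cc cd v; apply/cvgrPdist_le => e e_gt0.
have e4 : 0 < e / 4 by rewrite divr_gt0.
have strip f : measurable_fun setT f -> (forall s, mu (f @^-1` [set s]) = 0%E) ->
    forall g : V -> R, continuous g -> exists A : set (measurableTypeR R),
    [/\ is_interval A, measurable (f @^-1` A), (mu (f @^-1` A) <= (e / 4)%:E)%E, A (g v) &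
        \forall v' \near v, A (g v')].
  move=> mf null g cg.
  have [delta delta_gt0 lt_e] := measure_preimage_small mf (null (g v)) e4.
  exists `[g v - delta, g v + delta]%classic; split.
  - exact: interval_is_interval.
  - by rewrite -[X in measurable X]setTI; apply: mf => //; exact: measurable_itv.
  - exact: ltW.
  - by rewrite /= in_itv /= lerBlDr lerDl ltW.
  have /cvgrPdist_le /(_ _ delta_gt0) := cg v.
  by apply: filterS => v'; rewrite /= in_itv /= distrC -ler_distl.
have strip1 := strip _ measurable_fst vertical_line_null.
have strip2 := strip _ measurable_snd horizontal_line_null.
have [A [iA mA leA Av nearA]] := strip1 a ca.
have [B [iB mB leB Bv nearB]] := strip1 b cb.
have [C [iC mC leC Cv nearC]] := strip2 c cc.
have [D [iD mD leD Dv nearD]] := strip2 d cd.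
have mass_le a1 b1 c1 d1 a2 b2 c2 d2 : A a1 -> B b1 -> C c1 -> D d1 ->
    A a2 -> B b2 -> C c2 -> D d2 -> rect_mass a1 b1 c1 d1 <= rect_mass a2 b2 c2 d2 + e.
  move=> Aa1 Bb1 Cc1 Dd1 Aa2 Bb2 Cc2 Dd2.
  pose U := rect a2 b2 c2 d2 `|` (fst @^-1` A `|` fst @^-1` B) `|`
            (snd @^-1` C `|` snd @^-1` D).
  have sub : rect a1 b1 c1 d1 `<=` U.
    move=> [x y] [/=]; rewrite !in_itv /= => /andP[ax xb] /andP[cy yd].
    have [xa|a2x] := ltP x a2.
      by left; right; left; apply: (iA a1 a2); rewrite // ax ltW.
    have [bx|xb2] := ltP b2 x.
      by left; right; right; apply: (iB b2 b1); rewrite // xb ltW.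
    have [yc|c2y] := ltP y c2.
      by right; left; apply: (iC c1 c2); rewrite // cy ltW.
    have [dy|yd2] := ltP d2 y.
      by right; right; apply: (iD d2 d1); rewrite // yd ltW.
    by left; left; split; rewrite /= in_itv /= ?a2x ?xb2 ?c2y.
  have mR := measurable_rect a2 b2 c2 d2.
  have mAB := measurableU _ _ mA mB; have mCD := measurableU _ _ mC mD.
  have mRAB := measurableU _ _ mR mAB.
  rewrite -lee_fin EFinD !rect_massE.
  apply: (@le_trans _ _ (mu U)).
    by apply: le_measure; rewrite ?inE //; [exact: measurable_rect|exact: measurableU].
  apply: (le_trans (measureU2 mu mRAB mCD)).
  rewrite (_ : e%:E = (e / 4)%:E + (e / 4)%:E + ((e / 4)%:E + (e / 4)%:E))%E; last first.
    by rewrite -!EFinD; congr EFin; lra.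
  rewrite addeA; apply: leeD; last by apply: (le_trans (measureU2 mu mC mD)); exact: leeD.
  apply: (le_trans (measureU2 mu mR mAB)); apply: leeD => //.
  by apply: (le_trans (measureU2 mu mA mB)); exact: leeD.
near=> v'; rewrite ler_distl.
have Av' : A (a v') by near: v'.
have Bv' : B (b v') by near: v'.
have Cv' : C (c v') by near: v'.
have Dv' : D (d v') by near: v'.
by rewrite lerBlDr !mass_le.
Unshelve. all: by end_near. Qed.

End RectangleMeasure.

(** * Division of the square *)

Lemma exists_le_of_sum_eq (R : realType) p (F G : 'I_p -> R) : (0 < p)%N ->
  \sum_i F i = \sum_i G i -> exists i, F i <= G i.
Proof.
move=> p_gt0 eq_FG; apply: contrapT => none.
have lt_GF i : G i < F i by rewrite ltNge; apply/negP => le_i; apply: none; exists i.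
suff : \sum_i G i < \sum_i F i by rewrite eq_FG ltxx.
apply: ltr_sum => //.
by apply/hasP; exists (Ordinal p_gt0); rewrite ?mem_index_enum.
Qed.

Lemma eq_of_sum_eq (R : realType) p (F G : 'I_p -> R) :
  (forall i, F i <= G i) -> \sum_i F i = \sum_i G i -> forall i, F i = G i.
Proof.
move=> le_FG eq_FG i; apply/eqP; rewrite eq_sym -subr_eq0; apply/eqP.
apply: (@psumr_eq0P _ _ xpredT (fun i => G i - F i)) => //.
  by move=> j _; rewrite subr_ge0.
by rewrite big_split /= sumrN eq_FG subrr.
Qed.

Definition cut (R : realType) p (x : 'I_p -> R) (k : nat) : R :=
  \sum_(i < p | (i < k)%N) x i.

Lemma cutS (R : realType) p (x : 'I_p -> R) (i : 'I_p) :
  cut x i.+1 = cut x i + x i.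
Proof.
rewrite /cut (bigD1 i) //= addrC; congr (_ + _); apply: eq_bigl => j.
by rewrite ltnS ltn_neqAle andbC.
Qed.

Lemma cut_partition (R : realType) p (x : 'I_p -> R) :
  (forall i, 0 <= x i) -> \sum_i x i = 1 ->
  exists I : partition01 R p, forall k, I k = cut x k.
Proof.
move=> x_ge0 sum_x.
have cut0 : cut x 0 = 0 by rewrite /cut big_pred0.
have cutp : cut x p = 1.
  by rewrite -sum_x; apply: eq_bigl => i; rewrite ltn_ord.
have cut_le (i : 'I_p) : cut x i <= cut x i.+1 by rewrite cutS lerDl.
by exists (Partition01 cut0 cutp cut_le).
Qed.

Section Division.
Variables (R : realType)
  (mu : probability (measurableTypeR R * measurableTypeR R)%type R)
  (n m : nat).
Hypothesis mu_ac : absolutely_continuous mu.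

(* A point of the simplex in R^(n + m) holds the lengths of both partitions,
   each scaled by 1/2. *)
Definition xlen (v : 'rV[R]_(n + m)) (i : 'I_n) : R := 2 * v ord0 (lshift m i).
Definition ylen (v : 'rV[R]_(n + m)) (j : 'I_m) : R := 2 * v ord0 (rshift n j).
Definition cell_mass (v : 'rV[R]_(n + m)) (i : 'I_n) (j : 'I_m) : R :=
  rect_mass mu (cut (xlen v) i) (cut (xlen v) i.+1)
               (cut (ylen v) j) (cut (ylen v) j.+1).

Lemma xlen_continuous i : continuous (xlen^~ i).
Proof.
apply: continuous_mull; exact: coord_continuous.
Qed.

Lemma ylen_continuous j : continuous (ylen^~ j).
Proof.
by apply: continuous_mull; exact: coord_continuous.
Qed.

Lemma cell_mass_continuous i j : continuous (fun v => cell_mass v i j).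
Proof.
apply: (rect_mass_continuous mu_ac) => v; apply: continuous_sum => k;
  by [exact: xlen_continuous|exact: ylen_continuous].
Qed.

Lemma cell_mass_empty v i j : xlen v i = 0 \/ ylen v j = 0 -> cell_mass v i j = 0.
Proof.
move=> v0; apply: (rect_mass_degenerate mu_ac); rewrite !cutS.
by case: v0 => ->; rewrite addr0; [left|right].
Qed.

Lemma sum_xlen_ylen v : simplex R (n + m) v ->
  \sum_i xlen v i + \sum_j ylen v j = 2.
Proof.
case=> _ sum1; rewrite -!mulr_sumr -mulrDr -[RHS]mulr1 -sum1; congr (_ * _).
by rewrite big_split_ord.
Qed.

(** By [sum_xlen_ylen] the lengths [ylen] then also sum to 1, so these are the points that encode a
    pair of partitions. *)
Definition balanced : set 'rV[R]_(n + m) :=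
  simplex R (n + m) `&` [set v | \sum_i xlen v i = 1].

Lemma balanced_compact : compact balanced.
Proof.
apply: (@subclosed_compact _ _ (simplex R (n + m))) => [||v []//].
  apply: closedI.
    by apply: compact_closed; [exact: norm_hausdorff|exact: simplex_compact].
  apply: (@preimage_closed _ _ (fun v => \sum_i xlen v i) [set x | x = 1]).
    by move=> v _; apply: continuous_sum => i; exact: xlen_continuous.
  exact: closed_eq.
exact: simplex_compact.
Qed.

Lemma balanced_partitions v : balanced v ->
  exists (I : partition01 R n) (J : partition01 R m),
    forall i j, mu (seg I i `*` seg J j) = (cell_mass v i j)%:E.
Proof.
move=> [sv sumx]; have [v_ge0 _] := sv.
have [i|I IE] := cut_partition _ sumx; first by rewrite mulr_ge0.
have sumy : \sum_j ylen v j = 1 by have := sum_xlen_ylen sv; rewrite sumx; lra.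
have [j|J JE] := cut_partition _ sumy; first by rewrite mulr_ge0.
by exists I, J => i j; rewrite rect_massE /seg !IE !JE.
Qed.

Lemma approximate_division (a : 'I_n -> nat) (c c' : R) :
  (0 < n)%N -> (0 < m)%N -> 0 <= c' -> c' < c ->
  (forall i, (0 < a i)%N) -> (\sum_i a i)%N = m ->
  (forall v, balanced v -> exists i j, c <= cell_mass v i j) ->
  exists v (sigma : 'I_m -> 'I_n), [/\ balanced v,
    forall i, #|[set j | sigma j == i]%SET| = a i &
    forall j, c' < cell_mass v (sigma j) j].
Proof.
move=> n_gt0 m_gt0 c'_ge0 lt_c'c a_gt0 sum_a big_cell.
pose r v i j := Num.max 0 (cell_mass v i j - c').
pose tot v := \sum_i \sum_j r v i j.
have r_ge0 v i j : 0 <= r v i j by rewrite /r le_max lexx.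
have tot_ge0 v : 0 <= tot v by apply: sumr_ge0 => i _; apply: sumr_ge0.
(* A degenerate cell has mass 0, which does not exceed [c'] because [0 <= c']. *)
have r_empty v i j : xlen v i = 0 \/ ylen v j = 0 -> r v i j = 0.
  by move=> v0; rewrite /r cell_mass_empty // sub0r max_l // oppr_le0.
have cont_r i j : continuous (fun v => r v i j).
  by apply: continuous_excess; exact: cell_mass_continuous.
have cont_tot : continuous tot.
  by apply: continuous_sum => i; apply: continuous_sum => j; exact: cont_r.
(* Row labels are used where the rows have the smaller total length, column
   labels elsewhere: this forces both totals to agree at the point found by
   simplex_cover, where moreover no row and no column has too much mass. *)
pose L (k : 'I_(n + m)) : set 'rV[R]_(n + m) := match fintype.split k with
  | inl i => [set v | \sum_i xlen v i <= \sum_j ylen v j] `&`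
             [set v | m%:R * \sum_j r v i j <= (a i)%:R * tot v]
  | inr j => [set v | \sum_j ylen v j <= \sum_i xlen v i] `&`
             [set v | m%:R * \sum_i r v i j <= tot v]
  end.
have L_row v i : L (lshift m i) v =
    ((\sum_i xlen v i <= \sum_j ylen v j) /\
     (m%:R * \sum_j r v i j <= (a i)%:R * tot v)).
  by rewrite /L; have := unsplitK (inl i : 'I_n + 'I_m); rewrite /= => ->.
have L_col v j : L (rshift n j) v =
    ((\sum_j ylen v j <= \sum_i xlen v i) /\
     (m%:R * \sum_i r v i j <= tot v)).
  by rewrite /L; have := unsplitK (inr j : 'I_n + 'I_m); rewrite /= => ->.
have sum_rows v : \sum_i m%:R * \sum_j r v i j = \sum_i (a i)%:R * tot v.
  by rewrite -mulr_sumr -mulr_suml -natr_sum sum_a.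
have sum_cols v : \sum_j m%:R * \sum_i r v i j = \sum_(j < m) tot v.
  by rewrite -mulr_sumr exchange_big /= sumr_const card_ord -[RHS]mulr_natl.
have [|k|v sv|v sv v_L] := @simplex_cover R (n + m) L.
- by rewrite addn_gt0 n_gt0.
- have cx : continuous (fun v => \sum_i xlen v i).
    by apply: continuous_sum => i; exact: xlen_continuous.
  have cy : continuous (fun v => \sum_j ylen v j).
    by apply: continuous_sum => j; exact: ylen_continuous.
  rewrite /L; case: fintype.split => [i|j]; apply: closedI; apply: closed_le_continuous => //.
  + by apply: continuous_mull; apply: continuous_sum => j; exact: cont_r.
  + exact: continuous_mull.
  + by apply: continuous_mull; apply: continuous_sum => i; exact: cont_r.
- have [le_xy|/ltW le_yx] := leP (\sum_i xlen v i) (\sum_j ylen v j).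
    have [i le_i] := exists_le_of_sum_eq n_gt0 (sum_rows v).
    by exists (lshift m i) => //; rewrite L_row.
  have [j le_j] := exists_le_of_sum_eq m_gt0 (sum_cols v).
  by exists (rshift n j) => //; rewrite L_col.
have x_ge0 i : 0 <= xlen v i by rewrite mulr_ge0 // sv.1.
have y_ge0 j : 0 <= ylen v j by rewrite mulr_ge0 // sv.1.
have row_L i : 0 < xlen v i -> L (lshift m i) v.
  by rewrite /xlen pmulr_rgt0 // => /v_L.
have col_L j : 0 < ylen v j -> L (rshift n j) v.
  by rewrite /ylen pmulr_rgt0 // => /v_L.
have sum2 := sum_xlen_ylen sv.
have sum_gt0 p (F : 'I_p -> R) :
    (forall i, 0 <= F i) -> 0 < \sum_i F i -> exists i, 0 < F i.
  move=> F_ge0 sum_gt0; apply: contrapT => none; move: sum_gt0.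
  rewrite big1 ?ltxx // => i _; apply/eqP; rewrite eq_le F_ge0 andbT leNgt.
  by apply/negP => Fi; apply: none; exists i.
(* If the rows had the larger total, some row would have positive length; then [v] would lie in the
   set of that row, whose first condition says the contrary. *)
have le_xy : \sum_i xlen v i <= \sum_j ylen v j.
  rewrite leNgt; apply/negP => lt_yx.
  have [|i xi] := sum_gt0 _ _ x_ge0; first by rewrite (le_lt_trans _ lt_yx) ?sumr_ge0.
  by have := row_L i xi; rewrite L_row leNgt lt_yx => -[].
have le_yx : \sum_j ylen v j <= \sum_i xlen v i.
  rewrite leNgt; apply/negP => lt_xy.
  have [|j yj] := sum_gt0 _ _ y_ge0; first by rewrite (le_lt_trans _ lt_xy) ?sumr_ge0.
  by have := col_L j yj; rewrite L_col leNgt lt_xy => -[].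
have bv : balanced v by split=> //=; move: sum2 le_xy le_yx; lra.
(* Every row is within its share: by its set in the cover if its length is positive, trivially if it
   is degenerate. The shares sum to the same value as the rows, so no inequality is strict. *)
have row_eq := @eq_of_sum_eq R n (fun i => m%:R * \sum_j r v i j)
  (fun i => (a i)%:R * tot v) _ (sum_rows v).
have {}row_eq i : m%:R * \sum_j r v i j = (a i)%:R * tot v.
  apply: row_eq => {}i; have [xi|] := ltP 0 (xlen v i).
    by have := row_L i xi; rewrite L_row => -[].
  move=> xi; have {}xi : xlen v i = 0 by apply/eqP; rewrite eq_le xi x_ge0.
  rewrite big1 ?mulr0 ?mulr_ge0 // => j _; apply: r_empty; by left.
have col_eq := @eq_of_sum_eq R m (fun j => m%:R * \sum_i r v i j)
  (fun j => tot v) _ (sum_cols v).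
have {}col_eq j : m%:R * \sum_i r v i j = tot v.
  apply: col_eq => {}j; have [yj|] := ltP 0 (ylen v j).
    by have := col_L j yj; rewrite L_col => -[].
  move=> yj; have {}yj : ylen v j = 0 by apply/eqP; rewrite eq_le yj y_ge0.
  rewrite big1 ?mulr0 // => i _; apply: r_empty; by right.
have tot_gt0 : 0 < tot v.
  have [i [j le_c]] := big_cell v bv.
  rewrite /tot (bigD1 i) //= (bigD1 j) //= ltr_pwDl //; last first.
    by apply: sumr_ge0 => k _; apply: sumr_ge0.
  rewrite ltr_pwDl ?sumr_ge0 //.
  by rewrite /r lt_max subr_gt0 (lt_le_trans lt_c'c) ?orbT.
have [|i|j|sigma [card_sigma sigma_gt0]] :=
  @transport_support R n m a (fun i j => m%:R * r v i j) _ tot_gt0 a_gt0 sum_a.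
- by move=> i j; rewrite mulr_ge0.
- by rewrite -mulr_sumr.
- by rewrite -mulr_sumr.
exists v, sigma; split=> // j; have := sigma_gt0 j.
by rewrite pmulr_rgt0 ?ltr0n // /r lt_max ltxx subr_gt0.
Qed.

(** There are finitely many maps [sigma], so along thresholds increasing to [c] one of them recurs
    near a cluster point. Were some cell mass there below [c] by [gap], continuity and a threshold
    within [gap / 2] of [c] would clash. *)
Lemma exact_division (a : 'I_n -> nat) (c : R) :
  (0 < n)%N -> (0 < m)%N -> 0 < c ->
  (forall i, (0 < a i)%N) -> (\sum_i a i)%N = m ->
  (forall v, balanced v -> exists i j, c <= cell_mass v i j) ->
  exists v (sigma : 'I_m -> 'I_n), [/\ balanced v,
    forall i, #|[set j | sigma j == i]%SET| = a i &
    forall j, c <= cell_mass v (sigma j) j].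
Proof.
move=> n_gt0 m_gt0 c_gt0 a_gt0 sum_a big_cell.
(* The threshold lies in [[0, c)] for all [k]; at [k = 0] it is 0. The maps are taken as finite
   functions to serve as labels in a finite type. *)
have approx k : exists vs : 'rV[R]_(n + m) * {ffun 'I_m -> 'I_n}, [/\ balanced vs.1,
    forall i, #|[set j | vs.2 j == i]%SET| = a i &
    forall j, c - c / k.+1%:R < cell_mass vs.1 (vs.2 j) j].
  have [||v [sigma [bv card_s lt_s]]] := @approximate_division a c (c - c / k.+1%:R)
    n_gt0 m_gt0 _ _ a_gt0 sum_a big_cell.
  - by rewrite subr_ge0 ler_pdivrMr ?ltr0n // ler_peMr ?ler1n // ltW.
  - by rewrite gtrBl divr_gt0 ?ltr0n.
  exists (v, [ffun j => sigma j]); split=> //= [i|j]; last by rewrite ffunE.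
  by rewrite -card_s; apply: eq_card => j; rewrite !inE ffunE.
have [vs vsP] := choice approx.
have bvs k : balanced (vs k).1 by have [] := vsP k.
have [p [sigma [bp clp]]] :=
  compact_cluster_seq (fun k => (vs k).2) balanced_compact bvs.
exists p, sigma; split=> // [i|j].
  have [k [_ _ <-]] := clp _ filterT 0%N.
  by have [] := vsP k.
rewrite leNgt; apply/negP => lt_c; set gap := c - cell_mass p (sigma j) j.
have gap_gt0 : 0 < gap by rewrite subr_gt0.
have near_p :
    nbhs p [set v | cell_mass v (sigma j) j < cell_mass p (sigma j) j + gap / 2].
  have := @cell_mass_continuous (sigma j) j p => /cvgrPdist_lt /(_ (gap / 2)).
  rewrite divr_gt0 // => /(_ isT); apply: filterS => v /=.
  by rewrite ltr_distlC => /andP[].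
have [N lt_N] : exists N, c / (gap / 2) < N%:R.
  by exists (Num.bound (c / (gap / 2))); apply: archi_boundP; rewrite !divr_ge0 // ltW.
have [k [le_Nk /= lt_k sk]] := clp _ near_p N.
have [_ _ /(_ j)] := vsP k; rewrite sk => gt_k.
have small : c / k.+1%:R < gap / 2.
  rewrite ltr_pdivrMr ?ltr0n //; move: lt_N; rewrite ltr_pdivrMr ?divr_gt0 // => lt_N.
  by rewrite mulrC (lt_le_trans lt_N) // ler_pM2r ?divr_gt0 // ler_nat leqW.
have := ltrD (lt_trans gt_k lt_k) small.
by rewrite subrK -addrA -splitr /gap addrC subrK ltxx.
Qed.

End Division.

Theorem corollary3 (R : realType)
    (mu : probability (measurableTypeR R * measurableTypeR R)%type R)
    (hmuQ : probability_on_square mu)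
    (hmu_ac : absolutely_continuous mu)
    (n m : nat) (hn : (0 < n)%N) (hnm : (n <= m)%N)
    (c : R) (hc : 0 < c) :
  (exists (I : partition01 R n) (J : partition01 R m),
     forall (i : 'I_n) (j : 'I_m), (mu (seg I i `*` seg J j) < c%:E)%E)
  \/
  (forall a : 'I_n -> nat,
     (forall i, (0 < a i)%N) -> (\sum_(i < n) a i)%N = m ->
     exists (I : partition01 R n) (J : partition01 R m) (sigma : 'I_m -> 'I_n),
       (forall i : 'I_n, #|[set j : 'I_m | sigma j == i]%SET| = a i) /\
       (forall j : 'I_m, (c%:E <= mu (seg I (sigma j) `*` seg J j))%E)).
Proof.
have m_gt0 : (0 < m)%N by exact: leq_trans hnm.
have [small|big] := pselect (exists (I : partition01 R n) (J : partition01 R m),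
  forall i j, (mu (seg I i `*` seg J j) < c%:E)%E); [by left|right => a a_gt0 sum_a].
have big_cell v : balanced v -> exists (i : 'I_n) (j : 'I_m), c <= cell_mass mu v i j.
  move=> /(@balanced_partitions R mu)[I [J muE]]; apply: contrapT => none.
  apply: big; exists I, J => i j; rewrite muE lte_fin ltNge; apply/negP => le_c.
  by apply: none; exists i, j.
have [v [sigma [bv card_sigma le_c]]] :=
  exact_division hmu_ac hn m_gt0 hc a_gt0 sum_a big_cell.
have [I [J muE]] := @balanced_partitions R mu _ _ _ bv.
by exists I, J, sigma; split=> // j; rewrite muE lee_fin.
Qed.
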